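(* Let $(\rho_n)_{n\geqslant 0}$ be a sequence of non-zero numbers with $\rho_0=1$, and let $(K_m(x))_{m\geqslant 0}$ be a sequence of polynomials in $x$. For $n\geqslant 1$ let $F_n(x)=\det H_n(x)$, where $H_n(x)$ is the weighted Hessenberg matrix attached to $(\rho_n)$ and $(K_m(x))$ (defined in the context), let $F(x;z)=1+\sum_{n\geqslant 1}F_n(x)\frac{z^n}{\rho_n}$, and define $L_n(x)$, $n\geqslant 1$, by $$\frac{\partial}{\partial x}\ln F(x;z)=\sum_{n\geqslant 1}L_n(x)\frac{z^n}{\rho_n}.$$ Then for every $n\geqslant 1$, $$\frac{\mathrm{d}}{\mathrm{d}x}F_n(x)=\det \widetilde{H}_n(x),$$ where $\widetilde{H}_n(x)$ is the $n\times n$ matrix $$\widetilde{H}_n(x)= \begin{pmatrix} L_1(x) & -1 & 0 & \cdots & 0\\ L_2(x) & \frac{\rho_2}{\rho_1\rho_1}K_0(x) & -1 & \cdots & 0\\ L_3(x) & \frac{\rho_3}{\rho_1\rho_2}K_1(x) & \frac{\rho_3}{\rho_2\rho_1}K_0(x)& \cdots & 0\\ \vdots & \vdots & \vdots & \ddots & -1\\ L_{n}(x)& \frac{\rho_n}{\rho_1\rho_{n-1}}K_{n-2}(x) & \frac{\rho_n}{\rho_2\rho_{n-2}}K_{n-3}(x)& \cdots & \frac{\rho_n}{\rho_{n-1}\rho_1}K_0(x) \end{pmatrix},$$ that is, its $(i,1)$ entry is $L_i(x)$ for $1\leqslant i\leqslant n$; for $2\leqslant j\leqslant i$ its $(i,j)$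 entry is $\frac{\rho_i}{\rho_{j-1}\rho_{i-j+1}}K_{i-j}(x)$; its $(i,i+1)$ entries are $-1$; and its $(i,j)$ entries with $j>i+1$ are $0$. Moreover, for every $n\geqslant 1$, $L_n(x)$ is given by the $n\times n$ determinant $$L_n(x)= \begin{vmatrix} \frac{\mathrm{d}}{\mathrm{d}x} K_0(x) & -1 & 0 & \cdots & 0\\ \frac{\mathrm{d}}{\mathrm{d}x} K_1(x) & \frac{\rho_2}{\rho_1\rho_1}K_0(x) & -1 & \cdots & 0\\ \frac{\mathrm{d}}{\mathrm{d}x} K_2(x) & \frac{\rho_3}{\rho_1\rho_2}K_1(x) & \frac{\rho_3}{\rho_2\rho_1}K_0(x) & \cdots & 0\\ \vdots & \vdots & \vdots & \ddots & -1\\ \frac{\mathrm{d}}{\mathrm{d}x} K_{n-1}(x) & \frac{\rho_n}{\rho_1\rho_{n-1}}K_{n-2}(x) & \frac{\rho_n}{\rho_2\rho_{n-2}}K_{n-3}(x) & \cdots & \frac{\rho_n}{\rho_{n-1}\rho_1}K_0(x) \end{vmatrix}$$ (the matrix obtained from $\widetilde H_n(x)$ by replacing the first-column entry $L_i(x)$ by $\frac{\mathrm{d}}{\mathrm{d}x}K_{i-1}(x)$ for $1\leqslant i\leqslant n$), which is equivalent to $$L_n(x)=\frac{\mathrm{d}}{\mathrm{d}x} K_{n-1}(x)+\sum_{k=1}^{n-1}\frac{\rho_n}{\rho_k\rho_{n-k}}K_{n-k-1}(x)L_k(x).$$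
   Context: The weighted Hessenberg matrix $H_n(x)=(h_{ij})_{1\leqslant i,j\leqslant n}$ attached to $(\rho_n)_{n\geqslant0}$ and $(K_m(x))_{m\geqslant 0}$ is defined by $$h_{ij}=\begin{cases}\dfrac{\rho_i}{\rho_{j-1}\rho_{i-j+1}}K_{i-j}(x), & 1\leqslant j\leqslant i,\\ -1, & j=i+1,\\ 0, & j>i+1.\end{cases}$$ Generating functions are formal power series in $z$ whose coefficients are polynomials in $x$; $\frac{\partial}{\partial x}\ln F(x;z)$ means $\left(\frac{\partial}{\partial x}F(x;z)\right)/F(x;z)$, where $F(x;z)$ has constant term $1$ in $z$. Empty sums are $0$. *)

(* Defs.v *)
From HB Require Import structures.
From mathcomp Require Import all_boot all_order all_algebra.

Set Implicit Arguments.
Unset Strict Implicit.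
Unset Printing Implicit Defensive.

Import GRing.Theory.
Local Open Scope ring_scope.

(* A formal power series in z over A is its coefficient sequence nat -> A;
   two series are compared coefficientwise, with =1. *)
Section FormalPowerSeries.
Variable A : comUnitRingType.
Implicit Types f g : nat -> A.

Definition fps_one : nat -> A := fun n => (n == 0%N)%:R.

Definition fps_mul f g : nat -> A :=
  fun n => \sum_(k < n.+1) f k * g (n - k)%N.

(* The first n coefficients of 1 / f, from
   g_0 = 1 / f_0 and g_n = - (1 / f_0) \sum_(1 <= k <= n) f_k g_(n-k). *)
Fixpoint fps_inv_prefix f (n : nat) : seq A :=
  if n is m.+1 then
    let s := fps_inv_prefix f m in
    rcons s ((f 0%N)^-1 *
      (if m == 0%N then 1 else - \sum_(1 <= k < m.+1) f k * s`_(m - k)))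
  else [::].

Definition fps_inv f : nat -> A := fun n => (fps_inv_prefix f n.+1)`_n.

Definition fps_div f g : nat -> A := fps_mul f (fps_inv g).

Lemma size_fps_inv_prefix f n : size (fps_inv_prefix f n) = n.
Proof. by elim: n => //= n IHn; rewrite size_rcons IHn. Qed.

Lemma nth_fps_inv_prefix f n i :
  (i < n)%N -> (fps_inv_prefix f n)`_i = fps_inv f i.
Proof.
elim: n => // n IHn; rewrite ltnS leq_eqVlt => /predU1P[-> //|lt_in].
by rewrite [fps_inv_prefix f n.+1]/= nth_rcons size_fps_inv_prefix lt_in IHn.
Qed.

Lemma fps_invE f n :
  fps_inv f n = (f 0%N)^-1 *
    (if n == 0%N then 1 else - \sum_(1 <= k < n.+1) f k * fps_inv f (n - k)).
Proof.
rewrite {1}/fps_inv /= nth_rcons size_fps_inv_prefix ltnn eqxx.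
case: eqP => // /eqP n_gt0; congr (_ * - _).
apply: eq_big_nat => k /andP[k_gt0 _]; congr (_ * _).
by rewrite nth_fps_inv_prefix // ltn_subrL k_gt0 lt0n.
Qed.

Lemma fps_mulV f : f 0%N \is a GRing.unit -> fps_mul f (fps_inv f) =1 fps_one.
Proof.
move=> f0U n; rewrite /fps_mul /fps_one.
rewrite -(big_mkord predT (fun k => f k * fps_inv f (n - k))) big_ltn // subn0.
rewrite {1}fps_invE mulVKr //; case: eqP => [->|_]; last by rewrite addNr.
by rewrite big_geq // addr0.
Qed.

End FormalPowerSeries.

Section WeightedHessenberg.
Variable R : fieldType.
Implicit Types (rho : nat -> R) (K L C a : nat -> {poly R}) (c : {poly R}).

(* The series c + \sum_(n >= 1) a_n z^n / rho_n; the value a 0 is not used. *)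
Definition weighted_gf rho c a : nat -> {poly R} :=
  fun n => if n == 0%N then c else (rho n)^-1 *: a n.

(* d/dx, coefficient by coefficient in z. *)
Definition fps_dx (f : nat -> {poly R}) : nat -> {poly R} :=
  fun n => (f n)^`().

(* d/dx (ln f), for f with constant term 1 in z. *)
Definition fps_dx_ln (f : nat -> {poly R}) : nat -> {poly R} :=
  fps_div (fps_dx f) f.

(* The entry h_ij, with the indices i and j counted from 1. *)
Definition hess_entry rho K (i j : nat) : {poly R} :=
  if (j <= i)%N then
    (rho i / (rho (j - 1)%N * rho (i - j + 1)%N)) *: K (i - j)%N
  else if j == i.+1 then -1 else 0.

(* Ordinals count from 0, hence the successors. *)
Definition hess_mx rho K (n : nat) : 'M[{poly R}]_n :=
  \matrix_(i < n, j < n) hess_entry rho K i.+1 j.+1.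

(* hess_mx with first column replaced by C_1, ..., C_n. *)
Definition hess_col_mx rho K C (n : nat) : 'M[{poly R}]_n :=
  \matrix_(i < n, j < n)
    if (j : nat) == 0%N then C i.+1 else hess_entry rho K i.+1 j.+1.

Definition hess_gf rho K : nat -> {poly R} :=
  weighted_gf rho 1 (fun n => \det (hess_mx rho K n)).

End WeightedHessenberg.

(* Main.v *)
Require Import Defs.
From HB Require Import structures.
From mathcomp Require Import all_boot all_order all_algebra.

(* Let u (hess_kernel below) be 1 - \sum_(n >= 1) K_(n-1) z^n / rho_n.
   Expanding a Hessenberg determinant along its last row shows that M_n is the
   determinant with first column C_1, ..., C_n exactly when
   u * \sum M_n z^n / rho_n equals \sum C_n z^n / rho_n.  Hence F = 1 / u,
   so that l = F' / F = - u' / u, i.e. u * l = - u' and u * F' = l, which are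
   the two claimed determinants. *)

Set Implicit Arguments.
Unset Strict Implicit.
Unset Printing Implicit Defensive.

Import GRing.Theory.
Local Open Scope ring_scope.

(** By induction, every row of the matrix but the last annihilates the vector of leading principal
    minors. The minor of size 0 is 1, so this combination of columns can replace the first one
    without changing the determinant. *)
Lemma det_hessenberg (R : comNzRingType) (h : nat -> nat -> R) (n : nat) :
    (forall i, h i i.+1 = -1) -> (forall i j, (i.+1 < j)%N -> h i j = 0) ->
  \det (\matrix_(i < n.+1, j < n.+1) h i j) =
    \sum_(k < n.+1) h n k * \det (\matrix_(i < k, j < k) h i j).
Proof.
move=> hS h0; pose D m := \det (\matrix_(i < m, j < m) h i j).
elim/ltn_ind: n => n IHn; set H := (X in \det X = _).
set S := RHS.
(* Multiplying by U replaces the first column of H by (0, ..., 0, S). *)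
pose U := \matrix_(i < n.+1, j < n.+1) if j == ord0 then D i else (i == j)%:R.
have detU : \det U = 1.
  rewrite det_trig => [|]; last first.
    apply/is_trig_mxP => i j ltij; rewrite mxE; case: eqP => [j0|_].
      by rewrite j0 in ltij.
    by rewrite -val_eqE /= ltn_eqF.
  rewrite big1 // => i _; rewrite mxE eqxx; case: eqP => [->|//].
  exact: det_mx00.
have HU0 i : (H *m U) i ord0 = if i == ord_max then S else 0.
  rewrite mxE (eq_bigr (fun k : 'I_n.+1 => h i k * D k)); last first.
    by move=> k _; rewrite !mxE eqxx.
  have [->//|neq_in] := eqVneq i ord_max.
  have lt_in : (i < n)%N.
    by rewrite ltn_neqAle -ltnS ltn_ord andbT.
  (* The terms [k <= i] add up to [D i.+1] by induction, the term [k = i.+1] is [- D i.+1], and the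
     later ones vanish. *)
  rewrite -(big_mkord predT (fun k => h i k * D k)).
  rewrite (big_cat_nat (n := i.+2)) //= big_nat_recr //= big_mkord.
  rewrite -(IHn _ lt_in) hS mulN1r subrr add0r big_nat.
  rewrite big1 // => k /andP[ltik _].
  by rewrite h0 ?mul0r.
have HUS i (j : 'I_n) : (H *m U) i (lift ord0 j) = h i j.+1.
  rewrite mxE (bigD1 (lift ord0 j)) //= big1 => [|k neq_kj]; last first.
    by rewrite !mxE /= (negPf neq_kj) mulr0.
  by rewrite !mxE /= eqxx mulr1 addr0.
transitivity (\det (H *m U)); first by rewrite det_mulmx detU mulr1.
rewrite (expand_det_col _ ord0) (bigD1 ord_max) //= big1 => [|i neq_in];
    last first.
  by rewrite HU0 (negPf neq_in) mul0r.
(* The remaining minor is lower triangular with diagonal entries -1; its determinant [(-1)^n]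
   cancels the cofactor sign. *)
rewrite HU0 eqxx addr0 /cofactor det_trig; last first.
  apply/is_trig_mxP => i j ltij; by rewrite 2!mxE HUS lift_max h0.
rewrite (eq_bigr (fun=> -1)) => [|i _]; last by rewrite 2!mxE HUS lift_max hS.
by rewrite prodr_const card_ord /= addn0 -exprD addnn -signr_odd odd_double
  mulr1.
Qed.

Section FormalPowerSeriesTheory.
Variable A : comUnitRingType.
Implicit Types f g h : nat -> A.

(** Reduces commutativity and associativity of [fps_mul] to those of polynomials. *)
Lemma coef_mul_truncation n f g k : (k <= n)%N ->
  (\poly_(i < n.+1) f i * \poly_(i < n.+1) g i)`_k = fps_mul f g k.
Proof.
move=> le_kn; rewrite coefM; apply: eq_bigr => i _.
rewrite !coef_poly !ltnS (leq_trans (leq_subr _ _) le_kn).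
by rewrite (leq_trans _ le_kn) // -ltnS.
Qed.

Lemma fps_mulC f g : fps_mul f g =1 fps_mul g f.
Proof. by move=> n; rewrite -!(coef_mul_truncation _ _ (leqnn n)) mulrC. Qed.

Lemma eq_fps_mul f f' g g' :
  f =1 f' -> g =1 g' -> fps_mul f g =1 fps_mul f' g'.
Proof. by move=> ff' gg' n; apply: eq_bigr => i _; rewrite ff' gg'. Qed.

Lemma fps_mulA f g h : fps_mul f (fps_mul g h) =1 fps_mul (fps_mul f g) h.
Proof.
move=> n; pose P f := \poly_(i < n.+1) f i.
transitivity ((P f * (P g * P h))`_n); last rewrite mulrA; rewrite coefM.
  apply: eq_bigr => i _; rewrite coef_poly ltn_ord.
  by rewrite coef_mul_truncation ?leq_subr.
apply: eq_bigr => i _; rewrite coef_poly ltnS leq_subr.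
by rewrite coef_mul_truncation // -ltnS.
Qed.

Lemma fps_mul1 f : fps_mul (@fps_one A) f =1 f.
Proof.
move=> n; rewrite /fps_mul big_ord_recl mul1r subn0 big1 ?addr0 // => i _.
by rewrite mul0r.
Qed.

End FormalPowerSeriesTheory.

Lemma fps_dx_mul (R : fieldType) (f g : nat -> {poly R}) n :
  fps_dx (fps_mul f g) n = fps_mul (fps_dx f) g n + fps_mul f (fps_dx g) n.
Proof.
rewrite /fps_dx /fps_mul raddf_sum -big_split.
by apply: eq_bigr => i _; rewrite /= derivM.
Qed.

Section WeightedHessenbergTheory.
Variables (R : fieldType) (rho : nat -> R) (K : nat -> {poly R}).
Hypotheses (rho0 : rho 0%N = 1) (rho_neq0 : forall n, rho n != 0).
Implicit Types C M : nat -> {poly R}.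

(** With u = [hess_kernel], this is [rho n] times the coefficient of [z^n] in
    [(1 - u) * \sum_(k >= 1) M k z^k / rho k]. *)
Definition weighted_conv M n : {poly R} :=
  \sum_(1 <= k < n)
    (rho n / (rho k * rho (n - k)%N)) *: (K (n - k - 1)%N * M k).

(** The leading principal submatrices have the same shape, and the term [k = 0] of the expansion is
    [C n] times the empty determinant. *)
Lemma det_hess_col_mx C n : (1 <= n)%N ->
  \det (hess_col_mx rho K C n) =
    C n + weighted_conv (fun k => \det (hess_col_mx rho K C k)) n.
Proof.
case: n => // n _.
pose h i j := if j == 0%N then C i.+1 else hess_entry rho K i.+1 j.+1.
rewrite (@det_hessenberg _ h) /=; first last.
- move=> i [|j] //= ltij.
  by rewrite /h /= /hess_entry leqNgt ltnS ltnW //= gtn_eqF.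
- by move=> i; rewrite /h /= /hess_entry ltnn eqxx.
rewrite big_ord_recl det_mx00 mulr1; congr (_ + _).
rewrite /weighted_conv big_add1 big_mkord; apply: eq_bigr => i _.
rewrite /h /= /bump /= add1n /hess_entry /= ltnS (ltn_ord i).
rewrite -scalerAl !subSS subn1 /= subn0 addn1 subnSK ?ltn_ord //.
by rewrite -subnS.
Qed.

(** The recurrence has only one solution, as [weighted_conv M n] involves [M k] for [1 <= k < n]
    only. *)
Lemma hess_col_mx_eqP C M :
  (forall n, (1 <= n)%N -> M n = \det (hess_col_mx rho K C n)) <->
  (forall n, (1 <= n)%N -> M n = C n + weighted_conv M n).
Proof.
split=> eqM n; last first.
  elim/ltn_ind: n => n IHn n_gt0; rewrite eqM // det_hess_col_mx //.
  by congr (_ + _); apply: eq_big_nat => k /andP[k_gt0 ltkn]; rewrite IHn.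
move=> n_gt0; rewrite eqM // det_hess_col_mx //; congr (_ + _).
by apply: eq_big_nat => k /andP[k_gt0 ltkn]; rewrite eqM.
Qed.

(** As [rho 0 = 1], the weights in the first column are 1. *)
Lemma hess_mx_col n :
  hess_mx rho K n = hess_col_mx rho K (fun i => K (i - 1)%N) n.
Proof.
apply/matrixP => i j; rewrite !mxE; case: eqP => // ->.
by rewrite /hess_entry /= rho0 mul1r subn1 addn1 divff ?scale1r.
Qed.

Definition hess_kernel := weighted_gf rho 1 (fun n => - K (n - 1)%N).

(** The two end terms of the Cauchy product give [M n] and [- c * K (n - 1)]; the inner ones give
    the convolution. *)
Lemma mul_hess_kernel c M n : (1 <= n)%N ->
  fps_mul hess_kernel (weighted_gf rho c M) n =
    (rho n)^-1 *: (M n - weighted_conv M n - c * K (n - 1)%N).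
Proof.
case: n => // n _; rewrite fps_mulC /fps_mul big_ord_recl big_ord_recr /=.
rewrite /bump /= add1n subnn subn0 /hess_kernel /weighted_gf /= mulr1.
rewrite (_ : \sum_(i < n) _ = - ((rho n.+1)^-1 *: weighted_conv M n.+1)).
  by rewrite scalerN mulrN -scalerAr 2!scalerBr addrC; apply: addrC.
rewrite /weighted_conv big_add1 big_mkord scaler_sumr -sumrN.
apply: eq_bigr => i _; rewrite /= add1n subSS subn_eq0 leqNgt ltn_ord /=.
rewrite scalerN mulrN -scalerAl -scalerAr !scalerA [M _ * _]mulrC.
by rewrite mulrA mulVf // mul1r invfM.
Qed.

Lemma mul_hess_kernel_eqP C M :
  fps_mul hess_kernel (weighted_gf rho 0 M) =1 weighted_gf rho 0 C <->
  (forall n, (1 <= n)%N -> M n = \det (hess_col_mx rho K C n)).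
Proof.
split=> [eqMC | /hess_col_mx_eqP eqM n].
  apply/hess_col_mx_eqP => n n_gt0.
  have := eqMC n; rewrite mul_hess_kernel // /weighted_gf gtn_eqF //.
  rewrite mul0r subr0 => /(scalerI (invr_neq0 (rho_neq0 n))) <-.
  by rewrite subrK.
case: n => [|n]; first by rewrite /fps_mul big_ord1 mulr0.
by rewrite mul_hess_kernel // [in LHS]eqM // addrK mul0r subr0.
Qed.

(** For [c = 1] the boundary term cancels the first-column entry [K (n - 1)] of the recurrence. *)
Lemma mul_hess_kernel_hess_gf :
  fps_mul hess_kernel (hess_gf rho K) =1 @fps_one _.
Proof.
case=> [|n]; first by rewrite /fps_mul big_ord1 mulr1.
have detF : \det (hess_mx rho K n.+1) = K (n.+1 - 1)%N +
    weighted_conv (fun m => \det (hess_mx rho K m)) n.+1.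
  rewrite hess_mx_col det_hess_col_mx //; congr (_ + _).
  by apply: eq_bigr => k _; rewrite hess_mx_col.
by rewrite mul_hess_kernel // detF addrK mul1r subrr scaler0.
Qed.

Lemma dx_hess_gf :
  fps_dx (hess_gf rho K) =1
    weighted_gf rho 0 (fun n => (\det (hess_mx rho K n))^`()).
Proof.
by case=> [|n]; rewrite /fps_dx /hess_gf /weighted_gf /= ?derivC ?derivZ.
Qed.

Lemma dx_hess_kernel n :
  fps_dx hess_kernel n = - weighted_gf rho 0 (fun n => (K (n - 1)%N)^`()) n.
Proof.
case: n => [|n]; rewrite /fps_dx /hess_kernel /weighted_gf /= ?derivC ?oppr0 //.
by rewrite derivZ derivN scalerN.
Qed.

(** The constant term 1 of F is a unit, so the division by F can be undone. *)
Lemma mul_hess_gf_dx_ln :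
  fps_mul (hess_gf rho K) (fps_dx_ln (hess_gf rho K)) =1 fps_dx (hess_gf rho K).
Proof.
move=> n; rewrite /fps_dx_ln /fps_div (eq_fps_mul (frefl _) (fps_mulC _ _)).
rewrite fps_mulA (eq_fps_mul (fps_mulV _) (frefl _)) ?fps_mul1 //.
exact: unitr1.
Qed.

(** Multiply [F' = F * l] by u and use [u * F = 1]. *)
Lemma mul_hess_kernel_dx_hess_gf :
  fps_mul hess_kernel (fps_dx (hess_gf rho K)) =1 fps_dx_ln (hess_gf rho K).
Proof.
move=> n; rewrite -(eq_fps_mul (frefl _) mul_hess_gf_dx_ln) fps_mulA.
by rewrite (eq_fps_mul mul_hess_kernel_hess_gf (frefl _)) fps_mul1.
Qed.

Lemma mul_hess_kernel_dx_ln_hess_gf :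
  fps_mul hess_kernel (fps_dx_ln (hess_gf rho K)) =1
    weighted_gf rho 0 (fun n => (K (n - 1)%N)^`()).
Proof.
have mulfu : fps_mul (hess_gf rho K) hess_kernel =1 @fps_one _.
  by move=> m; rewrite fps_mulC mul_hess_kernel_hess_gf.
(* Differentiating u * F = 1 gives u * F' = - u' * F, whence the claim since
   u * l = u * (u * F'). *)
have uf' n : fps_mul hess_kernel (fps_dx (hess_gf rho K)) n =
    fps_mul (weighted_gf rho 0 (fun n => (K (n - 1)%N)^`())) (hess_gf rho K) n.
  have /eqP := fps_dx_mul hess_kernel (hess_gf rho K) n.
  rewrite {1}/fps_dx mul_hess_kernel_hess_gf /fps_one.
  rewrite -polyC_natr derivC eq_sym addrC addr_eq0 => /eqP->.
  rewrite /fps_mul -sumrN; apply: eq_bigr => i _.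
  by rewrite dx_hess_kernel mulNr opprK.
move=> n; rewrite -(eq_fps_mul (frefl _) mul_hess_kernel_dx_hess_gf).
rewrite (eq_fps_mul (frefl _) uf') fps_mulC -fps_mulA.
by rewrite (eq_fps_mul (frefl _) mulfu) fps_mulC fps_mul1.
Qed.

End WeightedHessenbergTheory.

Theorem theorem2p1 (R : fieldType) (rho : nat -> R) (K L : nat -> {poly R})
  (rho0 : rho 0%N = 1) (rho_neq0 : forall n : nat, rho n != 0)
  (defL : fps_dx_ln (hess_gf rho K) =1 weighted_gf rho 0 L) :
  [/\ forall n : nat, (1 <= n)%N ->
        (\det (hess_mx rho K n))^`() = \det (hess_col_mx rho K L n),
      forall n : nat, (1 <= n)%N ->
        L n = \det (hess_col_mx rho K (fun i => (K (i - 1)%N)^`()) n),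
      forall n : nat, (1 <= n)%N ->
        L n = (K (n - 1)%N)^`() +
          \sum_(1 <= k < n)
            (rho n / (rho k * rho (n - k)%N)) *: (K (n - k - 1)%N * L k)
    & forall M : nat -> {poly R},
        (forall n : nat, (1 <= n)%N ->
          M n = \det (hess_col_mx rho K (fun i => (K (i - 1)%N)^`()) n))
        <->
        (forall n : nat, (1 <= n)%N ->
          M n = (K (n - 1)%N)^`() +
            \sum_(1 <= k < n)
              (rho n / (rho k * rho (n - k)%N)) *: (K (n - k - 1)%N * M k))].
Proof.
have detL : forall n : nat, (1 <= n)%N ->
    L n = \det (hess_col_mx rho K (fun i => (K (i - 1)%N)^`()) n).
  apply/mul_hess_kernel_eqP => // n; rewrite -mul_hess_kernel_dx_ln_hess_gf //.
  by apply: eq_fps_mul => // m; rewrite defL.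
split=> // [||M]; last exact: hess_col_mx_eqP; last exact/hess_col_mx_eqP.
(* Only the first claim is left: it is [u * F' = l] read through the determinant criterion. *)
apply/mul_hess_kernel_eqP => // n; rewrite -defL -mul_hess_kernel_dx_hess_gf //.
by apply: eq_fps_mul => // m; rewrite dx_hess_gf.
Qed.
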